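(* Let $P$ be a projective topological group. Then $H^{2}(P,A)=0$ for every abelian topological $P$-module $A$. In particular, for every Markov (respectively Graev) free topological group $F$, $H^{2}(F,A)=0$ for every abelian topological $F$-module $A$.
   Context: Topological groups and spaces are not assumed Hausdorff. For a topological group $G$, an abelian topological $G$-module is an abelian topological group $A$ (written multiplicatively) together with a continuous action $G\times A\to A$, $(g,a)\mapsto {}^{g}a$, by group automorphisms. Cohomology (in the sense of Hu): $H^2(G,A)$ is the second cohomology group of the complex of continuous inhomogeneous cochains. That is, it is the group of continuous maps $f:G\times G\to A$ satisfying ${}^{g}f(h,k)\, f(gh,k)^{-1} f(g,hk)\, f(g,h)^{-1}=1$ for all $g,h,k\in G$, modulo the subgroup of maps of the form $(g,h)\mapsto {}^{g}c(h)\, c(gh)^{-1} c(g)$ with $c:G\to A$ continuous (pointwise multiplication). $H^2(G,A)=0$ means that this group is trivial. A topological group $P$ is projective if for every continuous epimorphism (surjective homomorphism) of topological groups $\pi:B\to C$ having a continuous section (a continuous map $s:C\to B$, not necessarily a homomorphism, with $\pi s=\mathrm{Id}_C$), and every continuous homomorphism $f:P\to C$, there is a continuous homomorphism $g:P\to B$ with $\pi g=f$. The Markov free topological group over a topological space $X$ is a pair $(F_X,\sigma_X)$, where $F_X$ is the free group on the set $X$ with canonical map $\sigma_X:X\to F_X$, equipped with the finest group topology making $\sigma_X$ continuous; every continuous map from $X$ to a topological group $H$ factors through $\sigma_X$ by a unique continuous homomorphism $F_X\to H$. The Graev free topological group over a pointed space $(X,e)$ is the analogous pair $(F^*_X,\sigma^*_X)$,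 where $F^*_X$ is the free group on the pointed set $(X,e)$ (so $\sigma^*_X(e)=1$) with the finest group topology making $\sigma^*_X$ continuous; every continuous map $X\to H$ to a topological group sending $e$ to $1$ factors through $\sigma_X^*$ by a unique continuous homomorphism $F^*_X\to H$. *)

(* Defs.v *)
From HB Require Import structures.
From mathcomp Require Import all_boot all_algebra.
From mathcomp Require Import all_classical topology tvs.

Set Implicit Arguments.
Unset Strict Implicit.
Unset Printing Implicit Defensive.

Import GRing.Theory.

Local Open Scope classical_set_scope.
Local Open Scope group_scope.

HB.mixin Record isTopologicalGroup G of Topological G & Group G := {
  mulg_continuous : continuous (fun x : G * G => x.1 * x.2);
  invg_continuous : continuous (fun x : G => x^-1)
}.

#[short(type="topGroupType")]
HB.structure Definition TopologicalGroup :=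
  {G of Topological G & Group G & isTopologicalGroup G}.

Definition group_hom (G H : groupType) (f : G -> H) : Prop :=
  {morph f : x y / x * y}.

Definition top_group_hom (G H : topGroupType) (f : G -> H) : Prop :=
  group_hom f /\ continuous f.

Definition projective (P : topGroupType) : Prop :=
  forall (B C : topGroupType) (pi : B -> C),
    top_group_hom pi ->
    (forall c, exists b, pi b = c) ->
    (exists2 s : C -> B, continuous s & forall c, pi (s c) = c) ->
    forall f : P -> C, top_group_hom f ->
    exists2 g : P -> B, top_group_hom g & forall x, pi (g x) = f x.

(* The coefficient group is written additively, so that the abelian           *)
(* topological groups are the ones of MathComp-Analysis.                      *)
Record topModule (G : topGroupType) := TopModule {
  tm_sort :> topologicalZmodType;
  act : G -> tm_sort -> tm_sort;
  act1 : forall a, act 1 a = a;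
  actM : forall g h a, act (g * h) a = act g (act h a);
  actD : forall g, {morph act g : a b / (a + b)%R};
  act_continuous : continuous (fun x : G * tm_sort => act x.1 x.2)
}.
Arguments act {G t} g a : rename.

Section SecondCohomology.
Variables (G : topGroupType) (A : topModule G).
Local Open Scope ring_scope.

Definition d1 (c : G -> A) : G * G -> A := fun '(g, h) =>
  act g (c h) - c (g * h)%g + c g.

Definition d2 (f : G * G -> A) : G * G * G -> A := fun '(g, h, k) =>
  act g (f (h, k)) - f ((g * h)%g, k) + f (g, (h * k)%g) - f (g, h).

Lemma actB (g : G) : {morph @act G A g : a b / a - b}.
Proof.
move=> a b; apply/eqP; rewrite eq_sym subr_eq; apply/eqP.
by rewrite -actD subrK.
Qed.

Let addrBBA (x y z w : A) : (x - y) + (z - w) = (x + z) - (y + w).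
Proof. by rewrite opprD addrACA. Qed.

Let opprBN (x y : A) : - (x - y) = (- x) - (- y).
Proof. exact: opprD. Qed.

Lemma d1B : zmod_morphism d1.
Proof.
move=> c c'; apply/funext => -[g h].
by rewrite !fctE /= actB opprBN !addrBBA.
Qed.

Lemma d2B : zmod_morphism d2.
Proof.
move=> f f'; apply/funext => -[[g h] k].
by rewrite !fctE /= actB opprBN !addrBBA (opprBN (f (g, h))) addrBBA.
Qed.

HB.instance Definition _ := GRing.isZmodMorphism.Build _ _ d1 d1B.
HB.instance Definition _ := GRing.isZmodMorphism.Build _ _ d2 d2B.

Let d2d1_aux (a b e p q r : A) :
  a - b + e - (a - p + q) + (b - p + r) - (e - q + r) = 0.
Proof.
have -> : a - b + e - (a - p + q) + (b - p + r) =
          a - b + e + (b - p + r) - (a - p + q) by rewrite addrAC.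
have -> : a - b + e + (b - p + r) = a - p + (e + r).
  by rewrite addrACA (addrA (a - b)) subrK.
have -> : e - q + r = e + r - q by rewrite addrAC.
by rewrite opprD addrACA subrr add0r addrC subrr.
Qed.

Lemma d2_d1 (c : G -> A) : d2 (d1 c) = 0.
Proof.
apply/funext => -[[g h] k]; rewrite /d2 /d1 actD actB -actM mulgA.
exact: d2d1_aux.
Qed.

Lemma continuous_subf (T : topologicalType) (f g : T -> A) :
  continuous f -> continuous g -> continuous (f - g).
Proof.
move=> cf cg x.
apply: (@continuous_comp _ _ _ (fun x => (f x, g x)) (fun y => y.1 - y.2)).
  by apply: cvg_pair; [exact: cf|exact: cg].
exact: sub_continuous.
Qed.

Lemma continuous_zerof (T : topologicalType) : continuous (0 : T -> A).
Proof. by move=> x; exact: cvg_cst. Qed.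

Definition cocycle2 : {pred G * G -> A} := fun f =>
  `[< continuous f /\ d2 f = 0 >].

Lemma cocycle2_zmod_closed : zmod_closed cocycle2.
Proof.
split=> [|f f' /asboolP[cf df] /asboolP[cf' df']]; apply/asboolP; split.
- exact: continuous_zerof.
- exact: raddf0.
- exact: continuous_subf.
- by rewrite d2B df df' subrr.
Qed.

HB.instance Definition _ :=
  GRing.isZmodClosed.Build (G * G -> A) cocycle2 cocycle2_zmod_closed.

Lemma continuous_d1 (c : G -> A) : continuous c -> continuous (d1 c).
Proof.
move=> cc.
have c1 : continuous (fun x : G * G => act x.1 (c x.2)).
  move=> x; apply: (@continuous_comp _ _ _ (fun x : G * G => (x.1, c x.2))
    (fun y : G * A => act y.1 y.2)); last exact: act_continuous.
  apply: cvg_pair; first exact: cvg_fst.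
  by apply: continuous_comp; [exact: cvg_snd|exact: cc].
have c2 : continuous (fun x : G * G => c (x.1 * x.2)%g).
  move=> x; apply: (@continuous_comp _ _ _ (fun x : G * G => (x.1 * x.2)%g) c).
    exact: mulg_continuous.
  exact: cc.
have c3 : continuous (fun x : G * G => - c x.1).
  move=> x; apply: continuous_comp; last exact: opp_continuous.
  by apply: continuous_comp; [exact: cvg_fst|exact: cc].
suff -> : d1 c = (fun x : G * G => act x.1 (c x.2)) -
    (fun x : G * G => c (x.1 * x.2)%g) - (fun x : G * G => - c x.1).
  by do 2![apply: continuous_subf => //].
by apply/funext => -[g h]; rewrite !fctE opprK.
Qed.

Lemma d1_cocycle2 (c : G -> A) : continuous c -> d1 c \in cocycle2.
Proof.
by move=> cc; apply/asboolP; split; [exact: continuous_d1|exact: d2_d1].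
Qed.

Definition Z2 : Type := {f : G * G -> A | f \in cocycle2}.
HB.instance Definition _ := SubChoice.on Z2.
HB.instance Definition _ := [SubChoice_isSubZmodule of Z2 by <:].

(* By d1_cocycle2, no coboundary is lost in restricting to Z2.                *)
Definition B2 : {pred Z2} := fun f =>
  `[< exists2 c : G -> A, continuous c & val f = d1 c >].

Lemma B2_zmod_closed : zmod_closed B2.
Proof.
split=> [|f f' /asboolP[c cc fE] /asboolP[c' cc' fE']]; apply/asboolP.
  by exists 0; [exact: continuous_zerof|rewrite !raddf0].
by exists (c - c'); [exact: continuous_subf|rewrite !raddfB /= fE fE'].
Qed.

HB.instance Definition _ := GRing.isZmodClosed.Build Z2 B2 B2_zmod_closed.

Definition H2 : zmodType := Quotient.quot B2.

End SecondCohomology.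
Arguments H2 {G} A.

(* The universal property defining the free group on the set X: here X is     *)
(* only a type, and no topology is involved.                                  *)
Definition free_group (X : Type) (F : groupType) (sigma : X -> F) : Prop :=
  forall (H : groupType) (f : X -> H),
  exists! phi : F -> H, group_hom phi /\ forall x, phi (sigma x) = f x.

Definition pointed_free_group (X : Type) (e : X) (F : groupType)
    (sigma : X -> F) : Prop :=
  sigma e = 1 /\
  forall (H : groupType) (f : X -> H), f e = 1 ->
  exists! phi : F -> H, group_hom phi /\ forall x, phi (sigma x) = f x.

(* tau is the family of open sets of a topology on G for which multiplication *)
(* and inversion are continuous. It need not be the one carried by G.         *)
Definition group_topology (G : groupType) (tau : set (set G)) : Prop :=
  [/\ tau setT,
      forall U V, tau U -> tau V -> tau (U `&` V),
      forall S : set (set G), S `<=` tau -> tau (\bigcup_(U in S) U),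
      forall U x y, tau U -> U (x * y) ->
        exists V W, [/\ tau V, tau W, V x, W y &
                        forall v w, V v -> W w -> U (v * w)] &
      forall U, tau U -> tau [set x | U x^-1]].

Definition finest_group_topology (X : topologicalType) (F : topGroupType)
    (sigma : X -> F) : Prop :=
  continuous sigma /\
  forall tau : set (set F), group_topology tau ->
    (forall U, tau U -> open (sigma @^-1` U)) -> tau `<=` open.

Definition markov_free (X : topologicalType) (F : topGroupType)
    (sigma : X -> F) : Prop :=
  free_group sigma /\ finest_group_topology sigma.

Definition graev_free (X : topologicalType) (e : X) (F : topGroupType)
    (sigma : X -> F) : Prop :=
  pointed_free_group e sigma /\ finest_group_topology sigma.

(* Main.v *)
Require Import Defs.
From HB Require Import structures.
From mathcomp Require Import all_boot all_algebra.
From mathcomp Require Import all_classical topology tvs.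

Set Implicit Arguments.
Unset Strict Implicit.
Unset Printing Implicit Defensive.

Import GRing.Theory.

Local Open Scope classical_set_scope.
Local Open Scope group_scope.

(** A continuous 2-cocycle f of G in A makes A x G, with the product topology
    and the law (a, g) (b, h) = (a + g b + f(g, h), g h), a topological group.
    Its projection onto G has the continuous section g |-> (0, g).  When G is
    projective, the identity of G therefore lifts to a continuous homomorphism
    u(g) = (c(g), g), and multiplicativity of u reads
    c(g h) = c(g) + g c(h) + f(g, h); that is, f is the coboundary of the
    continuous cochain - c ([projective_B2]).

    Free topological groups are projective ([finest_projective]).  Given
    pi : B -> C with a continuous section s and f : F -> C, the map
    s \o f \o sigma on the generators extends to an abstract homomorphism
    g : F -> B.  The preimages under g of the open sets of B form a group
    topology on F for which sigma is continuous, so it is coarser than the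
    finest one and g is continuous ([finest_hom_continuous]).  Finally pi \o g
    and f are homomorphisms that agree on the generators, so they are equal.
    In the pointed case the extension needs the base point to go to 1, which
    is obtained by translating s so that s(1) = 1. *)

(** * Continuity of composite maps *)

Lemma continuous_pair (T U V : topologicalType) (u : T -> U) (v : T -> V) :
  continuous u -> continuous v -> continuous (fun x => (u x, v x)).
Proof. by move=> cu cv x; apply: cvg_pair; [exact: cu | exact: cv]. Qed.

Lemma continuous_compose (T U V : topologicalType) (u : T -> U) (v : U -> V) :
  continuous u -> continuous v -> continuous (fun x => v (u x)).
Proof.
by move=> cu cv x; apply: (@continuous_comp _ _ _ u v); [exact: cu | exact: cv].
Qed.

Lemma continuous_compose2 (T U V W : topologicalType) (m : U * V -> W)
    (u : T -> U) (v : T -> V) :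
  continuous m -> continuous u -> continuous v ->
  continuous (fun x => m (u x, v x)).
Proof.
by move=> cm cu cv; apply: continuous_compose cm; exact: continuous_pair.
Qed.

Lemma continuous_fst (U V : topologicalType) : continuous (@fst U V).
Proof. by move=> x; exact: cvg_fst. Qed.

Lemma continuous_snd (U V : topologicalType) : continuous (@snd U V).
Proof. by move=> x; exact: cvg_snd. Qed.

(** * The extension of a group defined by a 2-cocycle *)

Section Extension.
Variables (G : topGroupType) (A : topModule G).
Local Open Scope ring_scope.

Lemma act0 (g : G) : act g (0 : A) = 0.
Proof. by rewrite -[in LHS](subrr 0) actB subrr. Qed.

Lemma actN (g : G) (a : A) : act g (- a) = - act g a.
Proof. by rewrite -[in LHS](sub0r a) actB act0 sub0r. Qed.

Section CocycleIdentities.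
Variable f : G * G -> A.
Hypothesis df : d2 f = 0.

Lemma cocycle_eq g h k :
  act g (f (h, k)) + f (g, (h * k)%g) = f ((g * h)%g, k) + f (g, h).
Proof.
have /eqP := congr1 (fun F => F (g, h, k)) df.
by rewrite /d2 /= -addrA addrACA -opprD subr_eq0 => /eqP.
Qed.

(** The cocycle identity at (1, 1, g), where f(1, g) cancels. *)
Lemma cocycle1l g : f (1%g, g) = f (1%g, 1%g).
Proof.
have := cocycle_eq 1%g 1%g g.
by rewrite act1 !mul1g => /addrI.
Qed.

(** The cocycle identity at (g, 1, 1), where f(g, 1) cancels. *)
Lemma cocycle1r g : f (g, 1%g) = act g (f (1%g, 1%g)).
Proof.
have := cocycle_eq g 1%g 1%g.
by rewrite !mulg1 => /addIr.
Qed.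

End CocycleIdentities.

(** The type mentions f so that the group law, which depends on f, can be
    attached to it. *)
Definition extension (f : Z2 A) : Type := (A * G)%type.

Section ExtensionGroup.
Variable f : Z2 A.
Let phi : G * G -> A := val f.

Let phi_cts : continuous phi.
Proof. by have /asboolP[] := valP f. Qed.

Let dphi : d2 phi = 0.
Proof. by have /asboolP[] := valP f. Qed.

HB.instance Definition _ := Topological.on (extension f).

(** On {1} x G a cocycle f has the constant value f(1, 1), possibly nonzero,
    which the unit has to compensate. *)
Definition ext_one : extension f := (- phi (1%g, 1%g), 1%g).

Definition ext_mul (x y : extension f) : extension f :=
  (x.1 + act x.2 y.1 + phi (x.2, y.2), (x.2 * y.2)%g).

(** The first component is the only one that makes this a left inverse; that
    it is also a right inverse uses the cocycle identity at (g, g^-1, g). *)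
Definition ext_inv (x : extension f) : extension f :=
  (- phi (1%g, 1%g) - phi ((x.2)^-1%g, x.2) - act (x.2)^-1%g x.1,
   (x.2)^-1%g).

(** Associativity is exactly the cocycle identity. *)
Lemma ext_mulA : associative ext_mul.
Proof.
move=> [a g] [b h] [c k]; apply: injective_projections => /=; last exact: mulgA.
rewrite !actD actM -!addrA; do 2 congr (_ + _).
by rewrite cocycle_eq // [RHS]addrCA; congr (_ + _); exact: addrC.
Qed.

Lemma ext_mul1x : left_id ext_one ext_mul.
Proof.
move=> [a g]; rewrite /ext_mul /= mul1g act1 (cocycle1l dphi g).
by rewrite addrAC addNr add0r.
Qed.

Lemma ext_mulx1 : right_id ext_one ext_mul.
Proof.
move=> [a g]; rewrite /ext_mul /= mulg1 actN (cocycle1r dphi g).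
by rewrite subrK.
Qed.

Lemma ext_mulVx : left_inverse ext_one ext_inv ext_mul.
Proof.
by move=> [a g]; rewrite /ext_mul /= mulVg subrK subrK.
Qed.

Lemma ext_mulxV : right_inverse ext_one ext_inv ext_mul.
Proof.
move=> [a g]; apply: injective_projections => /=; last exact: mulgV.
rewrite !actB actN -actM mulgV act1 addrC.
have := cocycle_eq dphi g g^-1%g g.
rewrite mulgV mulVg (cocycle1l dphi g) (cocycle1r dphi g) => E.
rewrite [a + _]addrCA subrr addr0 -opprD addrC.
by rewrite [act g _ + act g _]addrC E opprD subrK.
Qed.

HB.instance Definition _ := isGroup.Build (extension f)
  ext_mulA ext_mul1x ext_mulx1 ext_mulVx ext_mulxV.

Lemma ext_mul_continuous :
  continuous (fun x : extension f * extension f => (x.1 * x.2)%g).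
Proof.
pose T := ((A * G) * (A * G))%type.
have ca : continuous (fun x : T => x.1.1).
  exact: continuous_compose (@continuous_fst _ _) (@continuous_fst _ _).
have cg : continuous (fun x : T => x.1.2).
  exact: continuous_compose (@continuous_fst _ _) (@continuous_snd _ _).
have cb : continuous (fun x : T => x.2.1).
  exact: continuous_compose (@continuous_snd _ _) (@continuous_fst _ _).
have ch : continuous (fun x : T => x.2.2).
  exact: continuous_compose (@continuous_snd _ _) (@continuous_snd _ _).
apply: (@continuous_pair T).
  apply: (continuous_compose2 add_continuous); last first.
    exact: (continuous_compose2 phi_cts cg ch).
  apply: (continuous_compose2 add_continuous ca).
  exact: (continuous_compose2 (@act_continuous G A) cg cb).
exact: (continuous_compose2 mulg_continuous cg ch).
Qed.

Lemma ext_inv_continuous : continuous (fun x : extension f => x^-1%g).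
Proof.
have ci : continuous (fun x : A * G => (x.2)^-1%g).
  exact: continuous_compose (@continuous_snd _ _) invg_continuous.
apply: (@continuous_pair (A * G)%type) => //.
apply: (continuous_compose2 (@sub_continuous A)).
  apply: (continuous_compose2 (@sub_continuous A)); first exact: cst_continuous.
  exact: (continuous_compose2 phi_cts ci (@continuous_snd _ _)).
exact: (continuous_compose2 (@act_continuous G A) ci (@continuous_fst _ _)).
Qed.

HB.instance Definition _ := isTopologicalGroup.Build (extension f)
  ext_mul_continuous ext_inv_continuous.

(** A homomorphic lift of the identity of G to the extension is a splitting,
    and the opposite of its first component is a cochain with coboundary f. *)
Lemma projective_B2 : projective G -> f \in @B2 G A.
Proof.
move=> projG.
have pi_hom : top_group_hom (snd : extension f -> G).
  by split=> [x y|]; [|exact: continuous_snd].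
have sec_cts : continuous (fun g => (0, g) : extension f).
  by apply: continuous_pair => x; [exact: cst_continuous|exact: cvg_id].
have id_hom : top_group_hom (@id G) by split=> // x; exact: cvg_id.
have pi_surj g : exists x : extension f, x.2 = g by exists (0, g).
have pi_sec : exists2 s : G -> extension f,
    continuous s & forall g, (s g).2 = g by exists (fun g => (0, g)).
have [u [uM u_cts] uK] := projG _ _ _ pi_hom pi_surj pi_sec _ id_hom.
have c_cts : continuous (fun g => (u g).1).
  exact: continuous_compose u_cts (@continuous_fst _ _).
apply/asboolP; exists (fun g => - (u g).1).
  exact: continuous_compose c_cts (@opp_continuous A).
apply/funext => -[g h]; rewrite /d1 uM /= actN !uK opprK.
rewrite [(u g).1 + _]addrC -[_ + phi _]addrA (addKr (act g (u h).1)).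
by rewrite [_ + phi _]addrC addrK.
Qed.

End ExtensionGroup.

Lemma H2_eq0 : (forall f : Z2 A, f \in @B2 G A) -> forall x : H2 A, x = 0.
Proof.
move=> B2T; elim/quotW => f.
rewrite -[0](@pi_zeror _ _ _ _ _ (Quotient.quot (@B2 G A))).
by apply/eqP; rewrite -Quotient.idealrBE subr0.
Qed.

End Extension.

Lemma projective_H2_eq0 (P : topGroupType) (A : topModule P) :
  projective P -> forall x : H2 A, x = 0%R.
Proof. by move=> projP; apply: H2_eq0 => f; exact: projective_B2. Qed.

(** * Projectivity of free topological groups *)

Lemma group_hom1 (G H : groupType) (u : G -> H) : group_hom u -> u 1 = 1.
Proof. by move=> uM; apply: (mulgI (u 1)); rewrite -uM !mulg1. Qed.

Lemma group_homV (G H : groupType) (u : G -> H) :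
  group_hom u -> {morph u : x / x^-1}.
Proof.
by move=> uM x; apply: (mulgI (u x)); rewrite -uM !mulgV group_hom1.
Qed.

(** The topology induced by u is a group topology because u carries products
    and inverses to those of H, where they are continuous. *)
Lemma group_topology_preimage (G : groupType) (H : topGroupType) (u : G -> H) :
  group_hom u ->
  group_topology [set W | exists2 V, open V & W = u @^-1` V].
Proof.
move=> uM; split.
- by exists setT; [exact: openT|].
- move=> _ _ [V oV ->] [W oW ->].
  by exists (V `&` W); [exact: openI|rewrite preimage_setI].
- move=> S S_open.
  (* Several V may induce the same member of S: all of them are taken, which
     avoids choosing one. *)
  exists (\bigcup_(V in [set V | open V /\ S (u @^-1` V)]) V).
    by apply: bigcup_open => V [].
  rewrite predeqE => x; split=> [[W SW Wx]|[V [oV SV] Vx]].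
    by have [V oV WE] := S_open _ SW; exists V; rewrite -?WE //=; subst W.
  by exists (u @^-1` V).
- move=> _ x y [V oV ->] /=; rewrite uM => Vxy.
  have := mulg_continuous (u x, u y).
  move=> /(_ V) /= /(_ (open_nbhs_nbhs (conj oV Vxy))) [[N1 N2] [/= nx ny] N12].
  have [V1 [[oV1 V1x] sV1]] : exists U, open_nbhs (u x) U /\ U `<=` N1.
    by move: nx; rewrite nbhsE => -[U]; exists U.
  have [V2 [[oV2 V2y] sV2]] : exists U, open_nbhs (u y) U /\ U `<=` N2.
    by move: ny; rewrite nbhsE => -[U]; exists U.
  exists (u @^-1` V1), (u @^-1` V2); split=> //; [by exists V1|by exists V2|].
  move=> v w V1v V2w /=; rewrite uM.
  by apply: (N12 (u v, u w)); split; [exact: sV1|exact: sV2].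
- move=> _ [V oV ->]; exists ((fun y : H => y^-1) @^-1` V).
    by move: V oV; apply/continuousP; exact: invg_continuous.
  by rewrite predeqE => x /=; rewrite group_homV.
Qed.

(** The topology that u induces on F makes sigma continuous as soon as
    u \o sigma is, so each of its open sets is open in F. *)
Lemma finest_hom_continuous (X : topologicalType) (F H : topGroupType)
    (sigma : X -> F) (u : F -> H) :
  finest_group_topology sigma -> group_hom u ->
  continuous (u \o sigma) -> continuous u.
Proof.
move=> [_ finest] uM us_cts; apply/continuousP => V oV.
apply: (finest _ (group_topology_preimage uM)); last by exists V.
move=> _ [W oW ->]; rewrite -comp_preimage.
by move: W oW; apply/continuousP.
Qed.

(** Restricting the extension property to the maps v that are 1 wherever sigma
    is makes it hold in both kinds of free groups: a Markov one extends every v,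
    and in a Graev one sigma e = 1 forces v e = 1. *)
Lemma finest_projective (X : topologicalType) (F : topGroupType)
    (sigma : X -> F) :
  finest_group_topology sigma ->
  (forall (H : groupType) (v : X -> H),
     (forall x, sigma x = 1 -> v x = 1) ->
     exists! u : F -> H, group_hom u /\ forall x, u (sigma x) = v x) ->
  projective F.
Proof.
move=> finest ext B C pi [piM pi_cts] _ [s s_cts sK] f [fM f_cts].
have [sigma_cts _] := finest.
(* t is a continuous section with t 1 = 1, as s 1 lies in the kernel of pi. *)
pose t c := s c * (s 1)^-1.
have tK c : pi (t c) = c by rewrite piM group_homV // !sK invg1 mulg1.
have t_cts : continuous t.
  apply: (continuous_compose2 mulg_continuous s_cts).
  exact: cst_continuous.
pose v x := t (f (sigma x)).
have v1 x : sigma x = 1 -> v x = 1.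
  by move=> sx; rewrite /v sx group_hom1 // /t mulgV.
have [g [[gM gE] _]] := ext B v v1.
have g_cts : continuous g.
  apply: finest_hom_continuous finest gM _.
  rewrite (_ : g \o sigma = v); last by apply/funext.
  apply: continuous_compose t_cts.
  exact: continuous_compose sigma_cts f_cts.
exists g => // x.
(* Both f and pi \o g extend f \o sigma, so uniqueness identifies them. *)
have [|h [_ h_uniq]] := ext C (f \o sigma).
  by move=> y /= ->; exact: group_hom1.
suff -> : f = pi \o g by [].
rewrite -(h_uniq f) //; apply: h_uniq.
by split=> [a b|y] /=; rewrite ?gM ?piM // gE tK.
Qed.

Lemma markov_projective (X : topologicalType) (F : topGroupType)
    (sigma : X -> F) :
  markov_free sigma -> projective F.
Proof.
by move=> [free finest]; apply: (finest_projective finest) => H v _; exact: free.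
Qed.

Lemma graev_projective (X : topologicalType) (e : X) (F : topGroupType)
    (sigma : X -> F) :
  graev_free e sigma -> projective F.
Proof.
move=> [[sigma_e free] finest]; apply: (finest_projective finest) => H v v1.
by apply: free; exact: v1.
Qed.

Theorem corollary3p2 :
  (forall P : topGroupType, projective P ->
     forall (A : topModule P) (x : H2 A), x = 0%R) /\
  (forall (X : topologicalType) (F : topGroupType) (sigma : X -> F),
     markov_free sigma ->
     forall (A : topModule F) (x : H2 A), x = 0%R) /\
  (forall (X : topologicalType) (e : X) (F : topGroupType) (sigma : X -> F),
     graev_free e sigma ->
     forall (A : topModule F) (x : H2 A), x = 0%R).
Proof.
split=> [P projP A|]; first exact: projective_H2_eq0.
split=> [X F sigma /markov_projective|X e F sigma /graev_projective] projF A;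
  exact: projective_H2_eq0.
Qed.
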